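(* Let $\mu=\frac{\delta_0+\delta_1}{2}$ on $\mathbb{Z}$, let $p>1$, and let $(n_k)_{k\ge1}$ be any sequence of positive integers going to infinity and satisfying $$2n_k^{\,p}\ge n_{k+1}\ge n_k^{\,p}\quad\text{for all }k.$$ Let $(w_k)_{k\ge1}$ be any sequence of real numbers increasing to $\infty$. Then $$\sup_{|\gamma|=1}\sum_{k=1}^\infty w_k\left|\widehat\mu(\gamma)^{n_{k+1}}-\widehat\mu(\gamma)^{n_k}\right|=\infty.$$
   Context: $\delta_j$ is the unit point mass at $j\in\mathbb{Z}$, and $\widehat\mu(\gamma)=\sum_{s\in\mathbb{Z}}\mu(s)\gamma^s$ for $\gamma\in\mathbb{C}$, $|\gamma|=1$; thus here $\widehat\mu(\gamma)=\frac{1+\gamma}{2}$. *)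

(* Defs.v *)
From mathcomp Require Import all_boot all_order all_algebra.
From mathcomp Require Import complex.
From mathcomp Require Import all_classical all_reals all_analysis.

Set Implicit Arguments.
Unset Strict Implicit.
Unset Printing Implicit Defensive.

Import Order.TTheory GRing.Theory Num.Theory.
Import numFieldNormedType.Exports.

Local Open Scope classical_set_scope.
Local Open Scope ring_scope.
Local Open Scope complex_scope.

(* A measure on the discrete space of integers is represented by its mass
   function int -> R. *)
Definition point_mass (R : realType) (j : int) : int -> R :=
  fun s => (s == j)%:R.

Definition mu_half (R : realType) : int -> R :=
  fun s => (point_mass R 0 s + point_mass R 1 s) / 2.

(* The sum over all integers is a finite-support sum (it is 0 by convention
   when infinitely many terms are nonzero), so this is the Fourier transform
   for finitely supported mu, such as mu_half. *)
Definition fourier (R : realType) (mu : int -> R) (gamma : R[i]) : R[i] :=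
  \sum_(s \in [set: int]) (mu s)%:C * gamma ^ s.

Lemma fourier_mu_half (R : realType) (gamma : R[i]) :
  fourier (mu_half R) gamma = (1 + gamma) / 2.
Proof.
rewrite /fourier (fsbigE [:: 0; 1]) //=; last first.
  move=> i _; rewrite !inE => /norP[/negPf i0 /negPf i1].
  by rewrite /mu_half /point_mass i0 i1 addr0 mul0r mul0r.
rewrite !big_cons big_nil !ifT ?inE // expr0z expr1z.
rewrite /mu_half /point_mass /= addr0 add0r mulr1 addr0 mul1r.
by rewrite fmorphV rmorph_nat -[X in X + _]mulr1 -mulrDr mulrC.
Qed.

(* Main.v *)
Require Import Defs.
From mathcomp Require Import all_boot all_order all_algebra.
From mathcomp Require Import complex.
From mathcomp Require Import all_classical all_reals all_analysis.
From mathcomp Require Import ring lra.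

Import Order.TTheory GRing.Theory Num.Theory.
Import numFieldNormedType.Exports ComplexField.Normc.

Local Open Scope classical_set_scope.
Local Open Scope ring_scope.
Local Open Scope complex_scope.

(** The sum is large because of a single one of its terms. As [p > 1] and
    [n k] tends to infinity, [n k.+1] is eventually at least twice [n k]
    ([near_doubling]). The modulus of the Fourier transform [(1 + gamma) / 2]
    takes every value of the interval [0, 1] on the unit circle, so for each
    such [k] some [gamma] satisfies [`|(1 + gamma) / 2| ^ n k = 1/2]. The power
    [n k.+1] then has modulus at most [1/4], so the two powers are at least
    [1/4] apart ([exists_gap]) and the [k]-th term is at least [w k / 4], which
    is as large as desired.

    The weights may be negative at first, but only at finitely many indices.
    Since [(1 + gamma) / 2] lies in the unit disc, the terms at those indices
    are bounded below independently of [gamma] ([normc_gap_le2]), and every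
    later term is nonnegative, so the whole sum is at least the large term up
    to a fixed additive constant ([eseries_ge]). *)

Lemma exists_root_itv01 (R : realType) (c : R) (m : nat) :
  0 < c <= 1 -> (0 < m)%N -> exists2 r : R, 0 <= r <= 1 & r ^+ m = c.
Proof.
move=> c01 m_gt0; exists (c `^ m%:R^-1); last first.
  rewrite -powR_mulrn ?powR_ge0// -powRrM mulVf ?pnatr_eq0 -?lt0n//.
  by rewrite powRr1// ltW//; case/andP: c01.
have exp_ge0 : 0 <= m%:R^-1 :> R by rewrite invr_ge0 ler0n.
by have := ger_powR c01 exp_ge0; rewrite powRr0 powR_ge0.
Qed.

(** On the unit circle [`|1 + gamma| ^ 2 = 2 + 2 * Re gamma], so modulus [r]
    is reached at the point with real part [2 * r ^ 2 - 1]. *)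
Lemma exists_circle_modulus (R : realType) (r : R) : 0 <= r <= 1 ->
  exists2 gamma : R[i], normc gamma = 1 & normc (fourier (mu_half R) gamma) = r.
Proof.
move=> /andP[r_ge0 r_le1].
have r2_le1 : r ^+ 2 <= 1 by rewrite expr_le1.
have r2_ge0 : 0 <= r ^+ 2 by exact: sqr_ge0.
pose a := 2 * r ^+ 2 - 1.
have b_ge0 : 0 <= 1 - a ^+ 2.
  have -> : 1 - a ^+ 2 = 4 * (r ^+ 2 * (1 - r ^+ 2)) by rewrite /a; ring.
  by rewrite mulr_ge0// mulr_ge0// subr_ge0.
exists (a +i* Num.sqrt (1 - a ^+ 2)).
  by rewrite /normc sqr_sqrtr// addrC subrK sqrtr1.
rewrite fourier_mu_half.
have -> : (1 + (a +i* Num.sqrt (1 - a ^+ 2))) / 2 =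
    ((1 + a) / 2) +i* (Num.sqrt (1 - a ^+ 2) / 2) :> R[i].
  apply: (@mulIf _ 2); first by rewrite pnatr_eq0.
  rewrite divfK ?pnatr_eq0 //; apply/eqP.
  rewrite mulr_natr mulr2n eq_complex /= add0r.
  by apply/andP; split; apply/eqP; field.
rewrite /normc /= !expr_div_n sqr_sqrtr//.
have -> : (1 + a) ^+ 2 / 2 ^+ 2 + (1 - a ^+ 2) / 2 ^+ 2 = r ^+ 2.
  by rewrite /a; field.
by rewrite sqrtr_sqr ger0_norm.
Qed.

Lemma normc_ge0 (R : rcfType) (z : R[i]) : 0 <= normc z.
Proof. by case: z => a b; exact: sqrtr_ge0. Qed.

Lemma normcX (R : rcfType) (z : R[i]) (m : nat) :
  normc (z ^+ m) = normc z ^+ m.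
Proof.
by elim: m => [|m IH]; rewrite ?expr0 ?normc1// !exprS normcM IH.
Qed.

(** Choose [gamma] so that the [m]-th power has modulus exactly [1/2]: the
    [N]-th power then has modulus at most [(1/2) ^ 2], and the triangle
    inequality leaves a gap of [1/4]. *)
Lemma exists_gap (R : realType) (m N : nat) : (0 < m)%N -> (m.*2 <= N)%N ->
  exists2 gamma : R[i], normc gamma = 1 &
    4^-1 <= normc (fourier (mu_half R) gamma ^+ N -
                   fourier (mu_half R) gamma ^+ m).
Proof.
move=> m_gt0 mN.
have half01 : 0 < (2^-1 : R) <= 1 by lra.
have [r r01 rm] := exists_root_itv01 R 2^-1 m half01 m_gt0.
have [gamma g1 gr] := exists_circle_modulus R r r01.
exists gamma => //; set z := fourier _ _ in gr *.
have zm : normc (z ^+ m) = 2^-1 by rewrite normcX gr.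
have zN : normc (z ^+ N) <= 4^-1.
  have -> : 4^-1 = r ^+ m.*2 :> R by rewrite -addnn exprD rm; field.
  by rewrite normcX gr; case/andP: r01 => r0 r1; rewrite ler_wiXn2l.
have := le_normcD (z ^+ N) (z ^+ m - z ^+ N).
rewrite addrC subrK zm -[normc (z ^+ m - _)]normcN opprB; lra.
Qed.

Lemma normc_gap_le2 (R : realType) (gamma : R[i]) (m N : nat) :
  normc gamma = 1 ->
  normc (fourier (mu_half R) gamma ^+ N - fourier (mu_half R) gamma ^+ m) <= 2.
Proof.
move=> g1; rewrite fourier_mu_half; set z := _ / 2.
have z_le1 : normc z <= 1.
  have -> : normc z = normc (1 + gamma) / 2.
    rewrite normcM normcV; congr (_ / _).
    by rewrite normcMn normc1.
  have := le_normcD 1 gamma; rewrite g1 normc1; lra.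
have zX_le1 k : normc (z ^+ k) <= 1.
  by rewrite normcX exprn_ile1// normc_ge0.
have := le_normcD (z ^+ N) (- z ^+ m); rewrite normcN.
have := zX_le1 N; have := zX_le1 m; lra.
Qed.

(** The infinite sum is the limit of the partial sums, which are monotone from
    index [K] on; hence the limit exists and dominates the partial sum that
    stops just after index [j], whatever the signs of the first terms. *)
Lemma eseries_ge (R : realType) (u : nat -> R) (i K j : nat) :
  (i <= K)%N -> (K <= j)%N -> (forall k, (K <= k)%N -> 0 <= u k) ->
  ((\sum_(i <= k < K) u k + u j)%:E <= \sum_(i <= k <oo) (u k)%:E)%E.
Proof.
move=> iK Kj u_ge0; pose S m := \sum_(i <= k < m) u k.
have S_mono a b : (K <= a)%N -> (a <= b)%N -> S a <= S b.
  move=> Ka ab; rewrite /S (big_cat_nat (n := a) (p := b))//=;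
    last exact: leq_trans Ka.
  rewrite lerDl big_nat_cond sumr_ge0// => k /andP[/andP[ak _] _].
  by rewrite u_ge0// (leq_trans Ka).
have -> : (fun m => \sum_(i <= k < m) (u k)%:E)%E = (fun m => (S m)%:E).
  by apply/funext => m; rewrite sumEFin.
apply: lime_ge.
  have cvgS : cvgn (fun m => (S (m + K)%N)%:E).
    apply: ereal_nondecreasing_is_cvgn => a b ab.
    by rewrite lee_fin S_mono ?leq_addl// leq_add2r.
  apply/cvg_ex; case/cvg_ex: cvgS => l Sl; exists l.
  by move: Sl; rewrite (cvg_shiftn K (fun m => (S m)%:E)).
near=> m.
rewrite lee_fin (@le_trans _ _ (S j.+1))//.
  by rewrite /S big_nat_recr/= ?(leq_trans iK)// lerD2r S_mono.
by apply: S_mono; [exact: leqW | near: m; exact: nbhs_infty_ge].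
Unshelve. all: by end_near. Qed.

(** Write [x ^ p = x * x ^ (p - 1)]: the second factor is at least [2] as soon
    as [x >= 2 ^ (1 / (p - 1))]. *)
Lemma near_doubling (R : realType) (p : R) (n : nat -> nat) : 1 < p ->
  n k @[k --> \oo] --> \oo ->
  (forall k, (1 <= k)%N -> (n k)%:R `^ p <= (n k.+1)%:R :> R) ->
  \forall k \near \oo, ((n k).*2 <= n k.+1)%N.
Proof.
move=> hp hn_oo hn_growth; near=> k.
have k1 : (1 <= k)%N by near: k; exact: nbhs_infty_ge.
have p1_gt0 : 0 < p - 1 by rewrite subr_gt0.
have nk_ge : 2 `^ (p - 1)^-1 <= (n k)%:R :> R.
  near: k; move: hn_oo => /(_ [set N | 2 `^ (p - 1)^-1 <= (N%:R : R)]); apply.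
  exact: (nbhs_infty_ger (2 `^ (p - 1)^-1)).
rewrite -(ler_nat R) (le_trans _ (hn_growth k k1))//.
rewrite -mulr_powRB1 ?ler0n//; last lra.
rewrite -muln2 natrM ler_wpM2l ?ler0n//.
have := ge0_ler_powR (ltW p1_gt0) _ _ nk_ge.
by rewrite !nnegrE powR_ge0 ler0n -powRrM mulVf ?gt_eqF// powRr1//; apply.
Unshelve. all: by end_near. Qed.

Theorem lemma4p7 (R : realType) (p : R) (n : nat -> nat) (w : nat -> R)
  (hp : 1 < p)
  (hn_pos : forall k : nat, (1 <= k)%N -> (0 < n k)%N)
  (hn_oo : n k @[k --> \oo] --> \oo)
  (hn_growth : forall k : nat, (1 <= k)%N ->
     (n k)%:R `^ p <= (n k.+1)%:R :> R /\ (n k.+1)%:R <= 2 * (n k)%:R `^ p :> R)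
  (hw_mono : forall k l : nat, (1 <= k)%N -> (k <= l)%N -> w k <= w l)
  (hw_oo : w k @[k --> \oo] --> +oo) :
  ereal_sup
    [set (\sum_(1 <= k <oo)
            (w k * normc (fourier (mu_half R) gamma ^+ n k.+1
                         - fourier (mu_half R) gamma ^+ n k))%:E)%E
    | gamma in [set gamma : R[i] | normc gamma = 1]] = +oo%E.
Proof.
have w_ge (A : R) : \forall k \near \oo, A <= w k.
  by move/cvgryPge: hw_oo; exact.
have [K _ wK] := w_ge 0.
(* [K1] is positive, so that it can end a sum that starts at index 1, and [- C]
   bounds the sum of the first terms from below for every point of the unit circle. *)
pose K1 := K.+1; pose C := \sum_(1 <= k < K1) (`|w k| * 2).
apply: eq_infty => A.
have : \forall k \near \oo,
    [/\ (K1 <= k)%N, 4 * (A + C) <= w k & ((n k).*2 <= n k.+1)%N].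
  near=> k; split; near: k; [exact: nbhs_infty_ge | exact: w_ge |].
  by apply: (near_doubling R p n hp hn_oo) => k k1; case: (hn_growth k k1).
case/filter_ex => j [Kj wj nj].
have j_gt0 : (0 < j)%N by exact: leq_trans Kj.
have [gamma g1 gap] := exists_gap R (n j) (n j.+1) (hn_pos j j_gt0) nj.
pose d k := normc (fourier (mu_half R) gamma ^+ n k.+1
                   - fourier (mu_half R) gamma ^+ n k).
have d_ge0 k : 0 <= d k by exact: normc_ge0.
have wd_ge0 k : (K1 <= k)%N -> 0 <= w k * d k.
  by move=> K1k; rewrite mulr_ge0// wK//=; exact: ltnW.
apply: (@le_trans _ _ (\sum_(1 <= k <oo) (w k * d k)%:E)%E); last first.
  by apply: ereal_sup_ubound; exists gamma.
apply: le_trans (eseries_ge _ _ 1 K1 j _ Kj wd_ge0) => //.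
rewrite lee_fin.
have head_ge : - C <= \sum_(1 <= k < K1) w k * d k.
  rewrite -sumrN ler_sum// => k _.
  rewrite lerNl -mulNr (le_trans (ler_norm _))// normrM normrN ler_wpM2l//.
  by rewrite ger0_norm// /d normc_gap_le2.
have jth_ge : A + C <= w j * d j.
  have wj0 : 0 <= w j by apply: wK => /=; exact: ltnW.
  have : w j * 4^-1 <= w j * d j by rewrite ler_wpM2l.
  lra.
lra.
Unshelve. all: by end_near. Qed.
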